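(* Let $q\ge2$ be an integer, and suppose the mock character $f$ of mockulus $q$ does not vanish on the positive integers. Then there exist a root of unity $\xi$, a prime $p$, a positive integer $r$, and a Dirichlet character $\chi$ of modulus $p^r$ such that for all $n\ge1$, \[ f(n)=\xi^{v_p(n)}\,\chi\!\left(\frac{n}{p^{v_p(n)}}\right). \] Moreover, $f$ has mockulus $p$.
   Context: $v_p(n)$ denotes the largest integer $t$ with $p^t\mid n$. For an integer $q\ge2$, a sequence $(\alpha(n))_{n\ge0}$ is $q$-automatic if its $q$-kernel $\{(\alpha(q^km+r))_{m\ge0}: k\ge0,\ 0\le r<q^k\}$ is a finite set (of sequences). A map $\kappa:\mathbb{Z}\to\mathbb{C}$ is a mock character of mockulus $q$ if (i) $\kappa$ is completely multiplicative; (ii) the sequence $(\kappa(n))_{n\ge0}$ is $q$-automatic but not eventually periodic; and (iii) there exists an integer $d\ge1$ such that $\kappa(n)=0$ precisely when $n=0$ or $\gcd(n,d)\neq1$. A Dirichlet character of modulus $m$ is a completely multiplicative $m$-periodic $\chi:\mathbb{Z}\to\mathbb{C}$ with $\chi(n)=0$ iff $\gcd(n,m)\ne1$. *)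

(* Defs.v *)
From HB Require Import structures.
From mathcomp Require Import all_boot all_order all_algebra.
From mathcomp Require Import boolp classical_sets functions cardinality reals.
From mathcomp Require Import complex.

Set Implicit Arguments.
Unset Strict Implicit.
Unset Printing Implicit Defensive.

Import Order.TTheory GRing.Theory Num.Theory.

Local Open Scope classical_set_scope.
Local Open Scope ring_scope.

Definition q_kernel (T : Type) (q : nat) (a : nat -> T) : set (nat -> T) :=
  [set b | exists k r : nat,
     (r < q ^ k)%N /\ b = (fun m : nat => a (q ^ k * m + r)%N)].

(* Meaningful for [2 <= q] only; [mock_character] imposes that bound. *)
Definition automatic (T : Type) (q : nat) (a : nat -> T) : Prop :=
  finite_set (q_kernel q a).

Definition eventually_periodic (T : Type) (a : nat -> T) : Prop :=
  exists N t : nat,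
    (0 < t)%N /\ forall n : nat, (N <= n)%N -> a (n + t)%N = a n.

(* The clause [f 1 = 1] excludes the zero function; it is redundant in
   [mock_character] and [dirichlet_character], whose support contains 1. *)
Definition completely_multiplicative (C : nzRingType) (f : int -> C) : Prop :=
  f 1 = 1 /\ forall m n : int, f (m * n) = f m * f n.

Definition mock_character (C : nzRingType) (q : nat) (f : int -> C) : Prop :=
  [/\ (2 <= q)%N,
      completely_multiplicative f,
      automatic q (fun n : nat => f n%:Z),
      ~ eventually_periodic (fun n : nat => f n%:Z) &
      exists d : nat, (1 <= d)%N /\
        forall n : int, f n = 0 <-> n = 0 \/ gcdz n d%:Z <> 1].

Definition dirichlet_character (C : nzRingType) (m : nat) (chi : int -> C) :
    Prop :=
  [/\ completely_multiplicative chi,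
      forall n : int, chi (n + m%:Z) = chi n &
      forall n : int, chi n = 0 <-> gcdz n m%:Z <> 1].

Definition is_root_of_unity (C : nzRingType) (xi : C) : Prop :=
  exists2 k : nat, (0 < k)%N & k.-unity_root xi.

(* Main.v *)
(** Restrict f to a nonvanishing, completely multiplicative, q-automatic function F on
the naturals.

Two kernel elements coincide: F(Qn+r) = F(Qn+s) for all n, with r < s < Q = q^a.
Multiplicativity turns this into F(u) = F(u - Q(s-r)) for every u having a divisor v
prime to q with v + Qs = u mod Q^2.  As the kernel is finite, validity of F(u) = F(u-T),
T = Q(s-r), for all u = q^k W + r prime to q with T <= r < q^k (k arbitrary) amounts to
finitely many conditions on W, which the Chinese remainder theorem meets by giving each
such u a suitable divisor.  So F is T-periodic on the integers prime to q in [q^k W, q^k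
(W+1)), for every k.  For n large and k large, some multiples zn and z(n+T) lie in that
block, whence F(n+T) = F(n), first for large n and then for all n prime to q; cancelling
the part of T prime to q, the period may be taken to be a power of q.

Suppose q = m1 m2 with coprime m1, m2 > 1.  The kernel elements at the residues m1^k give
F(m2^k n + 1) = F(m2^l n + 1) with k < l.  Letting m2^k n + 1 be highly divisible by m1,
the right-hand side becomes constant by periodicity, so F(z) = 1 for all z = 1 mod m2^k.
With the roles of m1 and m2 exchanged this makes F constant, which is excluded.  Hence q
is a power of a prime p, and F on the integers prime to p is a Dirichlet character modulo
a power of p. *)

Require Import Defs.
From HB Require Import structures.
From mathcomp Require Import all_boot all_order all_algebra.
From mathcomp Require Import zify ring cyclic.
From mathcomp Require Import boolp classical_sets functions cardinality reals.
From mathcomp Require Import complex.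

Set Implicit Arguments.
Unset Strict Implicit.
Unset Printing Implicit Defensive.

Import Order.TTheory GRing.Theory Num.Theory.

Local Open Scope nat_scope.

(** * Divisibility and simultaneous congruences *)

Lemma coprime_solve (a v c : nat) : 0 < v -> coprime a v ->
  exists y, v %| a * y + c.
Proof.
move=> v0 cav; pose z := chinese a v 0 (c * v.-1).
have /dvdnP[y zE] : a %| z by rewrite /dvdn chinese_modl ?mod0n.
exists y; rewrite mulnC -zE /dvdn -modnDml chinese_modr // modnDml.
by rewrite -[X in _ + X]muln1 -mulnDr addn1 prednK // modnMl.
Qed.

Lemma smooth_coprime_part (q T : nat) : 0 < T ->
  exists a b c, [/\ T = b * c, b %| q ^ a & coprime c q].
Proof.
elim/ltn_ind: T => T IH T0.
have [cTq|] := boolP (coprime T q); first by exists 0, 1, T; rewrite mul1n dvd1n.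
rewrite /coprime => g1.
have g0 : 0 < gcdn T q by rewrite gcdn_gt0 T0.
have /dvdnP[T' TE] := dvdn_gcdl T q.
have [||a [b [c [T'E bq cq]]]] := IH T'; [by nia | by nia |].
exists a.+1, (gcdn T q * b), c; split=> //.
  by rewrite {1}TE T'E mulnC mulnA.
by rewrite expnS dvdn_mul // dvdn_gcdr.
Qed.

(** Induction on [l]: a new pair gets a divisor [v] prime to [B] and to [q], and [W] moves by a
    multiple of [B * Q ^ 2]. This preserves the earlier divisibilities because every earlier divisor
    divides [B]. *)
Lemma exists_residue_divisors (q Q s : nat) (l : seq (nat * nat)) :
  1 < q -> 0 < Q -> (forall x, coprime x q -> coprime x Q) ->
  q %| Q ->
  (forall kr, kr \in l -> coprime kr.2 q) ->
  exists W B, [/\ Q ^ 2 %| W, 0 < B, coprime B q & forall kr, kr \in l ->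
    exists v, [/\ v %| B, v %| q ^ kr.1 * W + kr.2 &
      v + Q * s = kr.2 %[mod Q ^ 2]]].
Proof.
move=> q1 Q0 cqQ qQ; elim: l => [|[k r] l IH] cl.
  by exists 0, 1; split; rewrite // coprime1n.
have [|W [B [QW B0 cBq H]]] := IH; first by move=> x xl; apply: cl; rewrite inE xl orbT.
have /= crq := cl (k, r) (mem_head _ _).
have cB : coprime (Q ^ 2) B by rewrite coprime_sym coprimeXr // cqQ.
(* The factor [Q.-1] acts as -1 modulo [Q], so [v0] is [r - Q * s] modulo [Q ^ 2]. Adding
   [Q ^ 2 * B] below makes [v] positive. *)
pose v0 := chinese (Q ^ 2) B (r + Q * s * Q.-1) 1.
pose v := v0 + Q ^ 2 * B.
have v0pos : 0 < v by rewrite addn_gt0 orbC muln_gt0 expn_gt0 Q0 B0.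
have v1 : v = r + Q * s * Q.-1 %[mod Q ^ 2].
  by rewrite /v addnC mulnC modnMDl chinese_modl.
have v2 : v = 1 %[mod B] by rewrite /v addnC modnMDl chinese_modr.
have cvB : coprime v B by rewrite -coprime_modl v2 coprime_modl coprime1n.
have cvq : coprime v q.
  have : v = r %[mod q].
    have qQ2 : q %| Q ^ 2 by rewrite dvdn_exp.
    rewrite -(modn_dvdm v qQ2) v1 modn_dvdm // -modnDmr.
    by rewrite -mulnA (eqP (dvdn_mulr _ qQ)) addn0.
  by rewrite -coprime_modl => ->; rewrite coprime_modl.
have [|y yP] := @coprime_solve (q ^ k * (B * Q ^ 2)) v (q ^ k * W + r) v0pos.
  by rewrite coprime_sym !coprimeMr cvB !coprimeXr ?cqQ.
exists (W + B * Q ^ 2 * y), (v * B); split.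
- by rewrite dvdn_addr // mulnAC dvdn_mull.
- by rewrite muln_gt0 v0pos.
- by rewrite coprimeMl cvq.
move=> [k' r']; rewrite inE => /predU1P[[-> ->]|/H /=[v' [v'B dv' e]]] /=.
- exists v; split; first exact: dvdn_mulr.
    have -> // : q ^ k * (W + B * Q ^ 2 * y) + r =
      q ^ k * (B * Q ^ 2) * y + (q ^ k * W + r) by ring.
  rewrite -modnDml v1 modnDml -addnA.
  have -> : r + (Q * s * Q.-1 + Q * s) = s * Q ^ 2 + r.
    by case: (Q) Q0 => // Q' _; rewrite /= expnS expn1; nia.
  by rewrite modnMDl.
- exists v'; split=> //; first exact: dvdn_mull.
  by rewrite mulnDr addnAC dvdn_add // dvdn_mull // -mulnA dvdn_mulr.
Qed.

(** * Finite sets and the pigeonhole principle *)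

Lemma finite_set_enum (T : Type) (A : set T) : finite_set A ->
  exists N (h : T -> nat), (forall x, A x -> h x < N) /\
    (forall x y, A x -> A y -> h x = h y -> x = y).
Proof.
case/finite_setP => N /card_set_bijP[h [hN hI _]].
by exists N, h; split=> [x /hN|x y Ax Ay]; last by apply: hI; rewrite inE.
Qed.

Lemma finite_set_pigeonhole (T : Type) (A : set T) : finite_set A ->
  exists N, forall g : nat -> T, (forall i, i <= N -> A (g i)) ->
    exists i j, [/\ i < j, j <= N & g i = g j].
Proof.
move=> /finite_set_enum[N [h [hN hI]]]; exists N => g gA.
have hlt (i : 'I_N.+1) : h (g i) < N by apply/hN/gA; rewrite -ltnS.
have [/injectiveP/leq_card|] := boolP (injectiveb (fun i => Ordinal (hlt i))).
  by rewrite !card_ord ltnn.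
case/injectivePn => i [j ij] /(congr1 val) /= e.
have gij : g i = g j by apply: hI e; apply: gA; rewrite -ltnS.
case: (ltngtP i j) => [lt|lt|/val_inj e2].
- by exists i, j; split=> //; rewrite -ltnS.
- by exists j, i; split=> //; rewrite -ltnS.
- by rewrite e2 eqxx in ij.
Qed.

Lemma finite_image_representatives (I : eqType) (T : Type) (D : set I)
    (g : I -> T) : finite_set (g @` D)%classic ->
  exists l : seq I, (forall x, x \in l -> D x) /\
    (forall x, D x -> exists2 y, y \in l & g x = g y).
Proof.
move=> /finite_set_enum[N [h [hN hI]]].
suff [l [lD lN]] : exists l : seq I, (forall x, x \in l -> D x) /\
    (forall x, D x -> h (g x) < N -> exists2 y, y \in l & g x = g y).
  by exists l; split=> // x Dx; apply: lN => //; apply: hN; exists x.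
elim: {hN}N => [|N [l [lD lN]]]; first by exists [::].
have [[y Dy yN]|no] := pselect (exists2 y, D y & h (g y) = N).
  exists (y :: l); split=> [x|x Dx]; first by rewrite inE => /predU1P[->|/lD].
  rewrite ltnS leq_eqVlt => /predU1P[xN|/lN[]// z zl e].
    exists y; first exact: mem_head.
    by apply: hI; [exists x|exists y|rewrite xN].
  by exists z; rewrite // inE zl orbT.
exists l; split=> // x Dx.
rewrite ltnS leq_eqVlt => /predU1P[xN|/lN]; last exact.
by case: no; exists x.
Qed.

(** * Translation invariance on blocks *)

Definition nonvanishing_multiplicative (K : idomainType) (F : nat -> K) :=
  [/\ F 1 = 1%R, forall m n, F (m * n) = (F m * F n)%R &
      forall n, 0 < n -> F n != 0%R].

Lemma coprime_period (K : idomainType) (F : nat -> K) (q T : nat) :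
  q %| T -> (forall n, 0 < n -> coprime n q -> F (n + T) = F n) ->
  forall j n, 0 < n -> coprime n q -> F (n + j * T) = F n.
Proof.
move=> /dvdnP[t TE] per; elim=> [|j IH] n n0 cn; first by rewrite addn0.
rewrite mulSnr addnA per ?IH //; first by rewrite addn_gt0 n0.
by rewrite -coprime_modl -modnDmr TE mulnA modnMl addn0 coprime_modl.
Qed.

(* With x = u / v = 1 + Q * t, m = Q * n + r and v * t = m + (s - r), the number
   x * m + (s - r) equals t * (u - Q * (s - r)). *)
Lemma translation_of_divisor (K : idomainType) (F : nat -> K) (Q r s u v : nat) :
  nonvanishing_multiplicative F -> r < s < Q ->
  (forall n, F (Q * n + r) = F (Q * n + s)) ->
  0 < u -> v %| u -> coprime v Q -> v + Q * s = u %[mod Q ^ 2] ->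
  F u = F (u - Q * (s - r)).
Proof.
move=> [_ FM Fnz] /andP[rs sQ] Frs u0 /dvdnP[x uE] cvQ e.
have Q1 : 1 < Q by lia.
have x0 : 0 < x by nia.
have v0 : 0 < v by nia.
have /dvdnP[t xE] : Q %| x - 1.
  rewrite -(Gauss_dvdl _ (_ : coprime Q v)) 1?coprime_sym // mulnBl mul1n.
  rewrite -eqn_mod_dvd; last by nia.
  have QQ : Q %| Q ^ 2 by rewrite dvdn_exp.
  by rewrite -uE -(modn_dvdm u QQ) -e modn_dvdm // addnC mulnC modnMDl.
have {}xE : x = 1 + Q * t by nia.
have vtE : v * t = s %[mod Q].
  have Q0 : 0 < Q by lia.
  (* Multiplied by [Q], this is [e] with [v] cancelled, because [u = v + Q * (v * t)]. *)
  apply/eqP; rewrite -(eqn_pmul2l Q0) !muln_modr // mulnn.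
  rewrite -(eqn_modDl v) e uE xE; apply/eqP; congr modn; ring.
have sE : (v * t) %% Q = s by rewrite vtE modn_small.
have t0 : 0 < t by case: (t) sE => // ; rewrite muln0 mod0n; lia.
pose n := v * t %/ Q.
have nE : v * t = Q * n + s by rewrite [LHS](divn_eq _ Q) sE mulnC.
have hu : Q * (s - r) < u by rewrite uE xE; nia.
apply: (mulfI (Fnz t t0)); rewrite -!FM.
have -> : t * (u - Q * (s - r)) = Q * (n + t * (Q * n + r)) + s.
  rewrite mulnBr uE xE.
  have -> : t * ((1 + Q * t) * v) = (1 + Q * t) * (v * t) by ring.
  have sh : s = r + (s - r) by lia.
  rewrite nE; move: (s - r) sh => h ->.
  apply: (@addIn (t * (Q * h))); rewrite subnK; first ring.
  by rewrite mulnA [t * Q]mulnC leq_mul //; lia.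
rewrite -Frs.
have -> : Q * (n + t * (Q * n + r)) + r = x * (Q * n + r) by rewrite xE; ring.
have -> : t * u = x * (v * t) by rewrite uE; ring.
by rewrite nE !FM Frs.
Qed.

Lemma automatic_germ_coincidence (T : Type) (F : nat -> T) (q : nat) :
  1 < q -> automatic q F ->
  exists k r s, [/\ 0 < k, r < s < q ^ k &
    forall n, F (q ^ k * n + r) = F (q ^ k * n + s)].
Proof.
move=> q1 /finite_set_pigeonhole[N HN].
(* All residues [1 + q * i] with [i <= N] are below [k], hence below [q ^ k], so the pigeonhole runs
   at one common level. *)
pose k := (q * N).+2; have kq : k < q ^ k by apply: ltn_expl.
have [i iN|i [j [ij jN e]]] := HN (fun i n => F (q ^ k * n + (1 + q * i))).
  exists k, (1 + q * i); split=> //; apply: leq_ltn_trans kq; rewrite /k; nia.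
exists k, (1 + q * i), (1 + q * j); split=> //.
- by apply/andP; split; [nia | apply: leq_ltn_trans kq; rewrite /k; nia].
- by move=> n; apply: (congr1 (fun g => g n) e).
Qed.

Lemma block_translation (K : idomainType) (F : nat -> K) (q : nat) :
  1 < q -> nonvanishing_multiplicative F -> automatic q F ->
  exists T W, [/\ 0 < T, q %| T & forall k r, T <= r < q ^ k -> coprime r q ->
    F (q ^ k * W + r) = F (q ^ k * W + (r - T))].
Proof.
move=> q1 FP aF.
have [a [r0 [s [a0 rs Frs]]]] := automatic_germ_coincidence q1 aF.
set Q := q ^ a in rs Frs; pose T := Q * (s - r0).
have qQ : q %| Q by rewrite dvdn_exp.
have Q0 : 0 < Q by rewrite expn_gt0; lia.
have cqQ x : coprime x q -> coprime x Q by apply: coprimeXr.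
pose D := [set kr : nat * nat | T <= kr.2 < q ^ kr.1 /\ coprime kr.2 q]%classic.
(* Pairs with equal [g] impose the same condition on [W], so finitely many pairs represent all of
   [D]. *)
pose g (kr : nat * nat) := ((fun m => F (q ^ kr.1 * m + kr.2)),
                            (fun m => F (q ^ kr.1 * m + (kr.2 - T)))).
have fin : finite_set (g @` D)%classic.
  apply: sub_finite_set (finite_setX aF aF) => _ [[k r] [/= /andP[Tr rq] _] <-].
  by split; [exists k, r | exists k, (r - T); split=> //; lia].
have [l [lD lrep]] := finite_image_representatives fin.
have [|W [B [QW B0 cB HW]]] := @exists_residue_divisors q Q s l q1 Q0 cqQ qQ.
  by move=> kr /lD[].
have T0 : 0 < T by rewrite muln_gt0 Q0; lia.
exists T, W; split=> [//||k r rT cr]; last first.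
- have [//|[k' r'] l' [e1 e2]] := lrep (k, r).
  have -> : F (q ^ k * W + r) = F (q ^ k' * W + r').
    exact: (congr1 (fun g => g W) e1).
  have -> : F (q ^ k * W + (r - T)) = F (q ^ k' * W + (r' - T)).
    exact: (congr1 (fun g => g W) e2).
  have [/= /andP[Tr' _] cr'] := lD _ l'.
  have [v /= [vB vu ve]] := HW _ l'.
  rewrite (@translation_of_divisor _ F Q r0 s _ v FP rs Frs) ?addnBA //.
  + by rewrite addn_gt0 orbC (leq_trans T0 Tr').
  + exact/cqQ/(coprime_dvdl vB).
  + by rewrite ve -[in RHS]modnDml (eqP (dvdn_mull _ QW)).
- exact: dvdn_mulr.
Qed.

Lemma block_walk (K : idomainType) (F : nat -> K) (q T W : nat) :
  q %| T -> (forall k r, T <= r < q ^ k -> coprime r q ->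
    F (q ^ k * W + r) = F (q ^ k * W + (r - T))) ->
  forall k j r, r + j * T < q ^ k -> coprime r q ->
    F (q ^ k * W + (r + j * T)) = F (q ^ k * W + r).
Proof.
move=> /dvdnP[t TE] H k; elim=> [|j IH] r hr cr; first by rewrite addn0.
have -> : r + j.+1 * T = r + j * T + T by ring.
rewrite H ?addnK ?IH //; first by nia.
  by apply/andP; split; lia.
have -> : r + j * T + T = j.+1 * t * q + r by rewrite TE; ring.
by rewrite -coprime_modl modnMDl coprime_modl.
Qed.

(** * Periodicity on the integers prime to q *)

Lemma periodic_on_coprimes (K : idomainType) (F : nat -> K) (q : nat) :
  1 < q -> nonvanishing_multiplicative F -> automatic q F ->
  exists T, [/\ 0 < T, q %| T &
    forall n, 0 < n -> coprime n q -> F (n + T) = F n].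
Proof.
move=> q1 FP aF; have [_ FM Fnz] := FP.
have [T [W [T0 qT HW]]] := block_translation q1 FP aF.
have {HW}walk := block_walk qT HW.
have large n : W * T < n -> coprime n q -> F (n + T) = F n.
  move=> nW cn; have n0 : 0 < n by lia.
  (* Here [n * y] is the first multiple of [n] beyond [q ^ k * W], and [z = q * y + 1] is prime to
     [q]. The gap [z * T] is about [q ^ k.+1 * W * T / n], less than the block length [q ^ k.+1]
     since [W * T < n]; the size of [k] absorbs the error terms. *)
  pose k := (q + 1) * n * (n + T); pose y := (q ^ k * W %/ n).+1.
  have kq : k < q ^ k by apply: ltn_expl.
  have y1 : q ^ k * W < n * y by rewrite /y [n * _]mulnC ltn_ceil.
  have y2 : n * y <= q ^ k * W + n.
    by rewrite /y [n * _]mulnC mulSnr leq_add2r leq_divM.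
  pose z := q * y + 1.
  have cz : coprime z q.
    by rewrite -coprime_modl /z mulnC modnMDl coprime_modl coprime1n.
  have zlow : q ^ k.+1 * W <= z * n by rewrite expnS /z; nia.
  have zhigh : z * (n + T) < q ^ k.+1 * (W + 1).
    rewrite -(ltn_pmul2l n0) expnS /z; move: (q ^ k) kq y2 => X; rewrite /k => kX yX.
    have h1 : q * (n * y) * (n + T) <= q * (X * W + n) * (n + T).
      by rewrite leq_mul // leq_mul.
    have h2 : q * X * (W * T + 1) <= q * X * n by rewrite leq_mul // addn1.
    have h3 : X <= q * X by rewrite leq_pmull; lia.
    have -> : n * ((q * y + 1) * (n + T)) =
      q * (n * y) * (n + T) + n * (n + T) by ring.
    have -> : n * (q * X * (W + 1)) = q * X * W * n + q * X * n by ring.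
    have e1 : q * (X * W + n) * (n + T) =
      q * X * W * n + q * X * (W * T) + q * n * (n + T) by ring.
    have e2 : (q + 1) * n * (n + T) = q * n * (n + T) + n * (n + T) by ring.
    by rewrite mulnDr muln1 in h2; lia.
  have [r zE] : exists r, z * n = q ^ k.+1 * W + r.
    by exists (z * n - q ^ k.+1 * W); rewrite subnKC.
  apply: (mulfI (Fnz z _)); first by rewrite /z addn1.
  rewrite -!FM mulnDr zE -addnA walk //.
    by move: zhigh; rewrite !mulnDr muln1 zE -addnA ltn_add2l.
  have : coprime (z * n) q by rewrite coprimeMl cz.
  by rewrite zE -coprime_modl expnS -mulnA mulnC modnMDl coprime_modl.
(* Multiplication by [c], which is prime to [q], pushes every positive [n] beyond [W * T], where
   [large] applies. *)
exists T; split=> // n n0 cn; pose c := 1 + W * T.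
have cc : coprime c q.
  case/dvdnP: qT => t tE.
  by rewrite -coprime_modl /c tE mulnA addnC modnMDl coprime_modl coprime1n.
apply: (mulfI (Fnz c _)) => //; rewrite -!FM mulnDr.
have step j : F (c * n + j * T) = F (c * n).
  elim: j => [|j IH]; first by rewrite addn0.
  rewrite mulSnr addnA large //; first by rewrite /c; nia.
  case/dvdnP: qT => t tE.
  rewrite -coprime_modl tE mulnA addnC modnMDl coprime_modl.
  by rewrite coprimeMl cc.
exact: step.
Qed.

(** If [T = b * c] with [b] dividing a power of [q] and [c] prime to [q], then [c] times a high
    power of [q] is a multiple of [T], and [F c] cancels. *)
Lemma power_period_on_coprimes (K : idomainType) (F : nat -> K) (q : nat) :
  1 < q -> nonvanishing_multiplicative F -> automatic q F ->
  exists2 a, 0 < a & forall j n, 0 < n -> coprime n q ->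
    F (n + j * q ^ a) = F n.
Proof.
move=> q1 FP aF; have [_ FM Fnz] := FP.
have [T [T0 qT per]] := periodic_on_coprimes q1 FP aF.
have [a [b [c [TE bq cq]]]] := smooth_coprime_part q T0.
have c0 : 0 < c by nia.
exists a.+1 => //; apply: coprime_period; first by rewrite expnS dvdn_mulr.
move=> n n0 cn; apply: (mulfI (Fnz c c0)); rewrite -!FM mulnDr.
have /dvdnP[d ->] : b %| q ^ a.+1 by rewrite expnS dvdn_mull.
have -> : c * (d * b) = d * T by rewrite TE; ring.
apply: (coprime_period qT per); first by rewrite muln_gt0 c0.
by rewrite coprimeMl cq.
Qed.

(** * Excluding coprime factors of the mockulus *)

Lemma coprime_subl (A b m : nat) :
  b <= A -> m %| A -> coprime b m -> coprime (A - b) m.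
Proof.
move=> bA mA cb.
have := dvdn_sub (dvdn_trans (dvdn_gcdr (A - b) m) mA) (dvdn_gcdl (A - b) m).
rewrite subKn // => gb.
by rewrite /coprime -dvdn1 -[X in _ %| X](eqP cb) dvdn_gcd gb dvdn_gcdr.
Qed.

Lemma constant_on_residue_one (K : idomainType) (F : nat -> K) (m1 m2 : nat) :
  1 < m1 -> 1 < m2 -> coprime m1 m2 ->
  nonvanishing_multiplicative F -> automatic (m1 * m2) F ->
  exists2 k, 0 < k & forall z, z = 1 %[mod m2 ^ k] -> F z = 1%R.
Proof.
move=> m1g m2g cm FP aF; have [F1 FM Fnz] := FP.
have q1 : 1 < m1 * m2 by nia.
have [a a0 per] := power_period_on_coprimes q1 FP aF.
have [N HN] := finite_set_pigeonhole aF.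
(* F (q ^ k * n + m1 ^ k) = F (m1 ^ k) * F (m2 ^ k * n + 1), and n = 0 shows that
   equal kernel elements have equal first factors. *)
have ha i : 0 < a + i by rewrite addn_gt0 a0.
have [i _|i [j [ij _ e]]] :=
    HN (fun i n => F ((m1 * m2) ^ (a + i) * n + m1 ^ (a + i))).
  exists (a + i), (m1 ^ (a + i)); split=> //.
  by rewrite ltn_exp2r //; nia.
have eF t n : F ((m1 * m2) ^ t * n + m1 ^ t) =
    (F (m1 ^ t)%N * F (m2 ^ t * n + 1)%N)%R.
  by rewrite -FM expnMn mulnDr muln1 mulnA.
have eq2 n : F (m2 ^ (a + i) * n + 1) = F (m2 ^ (a + j) * n + 1).
  have /= := congr1 (fun g => g 0) e; rewrite !eF !muln0 !add0n F1 !mulr1 => e0.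
  have /= := congr1 (fun g => g n) e; rewrite !eF e0.
  by apply/mulfI/Fnz; rewrite expn_gt0; lia.
have ajE : a + j = (j - i) + (a + i) by lia.
rewrite {}ajE in eq2.
move: (a + i) (ha i) (leq_addr i a) eq2 => k k0 ak eq2.
have : 0 < j - i by lia.
move: (j - i) eq2 => d eq2 d0.
have m2d : 1 < m2 ^ d by rewrite -[1](expn0 m2) ltn_exp2l.
(* Splitting off the [m1]-part [b1] of [m2 ^ d - 1] leaves [b2] prime to both [m1] and [m2]. *)
have [|i' [b1 [b2 [bE b1m cb2]]]] := @smooth_coprime_part m1 (m2 ^ d - 1).
  by lia.
have cb2' : coprime b2 m2.
  apply: (@coprime_dvdl _ (m2 ^ d - 1)); first by rewrite bE dvdn_mull.
  rewrite -(coprime_pexpr _ _ d0) -[X in coprime _ X](subnK (ltnW m2d)) addn1.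
  exact: coprimenS.
(* The totient gives [m1 ^ v = 1] modulo [m2 ^ k]; the other factor makes [m1 ^ v] divisible by
   [b1 * m1 ^ a.+1]. *)
pose v := totient (m2 ^ k) * (i' + a.+1).
have t0 : 0 < totient (m2 ^ k) by rewrite totient_gt0 expn_gt0; lia.
have vE : v = i' + a.+1 + (v - (i' + a.+1)) by rewrite subnKC // leq_pmull.
have M1 : m1 ^ v = 1 %[mod m2 ^ k].
  rewrite expnM -modnXm Euler_exp_totient ?coprimeXr //.
  by rewrite modnXm exp1n.
have /dvdnP[c' c'E] := b1m.
pose c := c' * (m1 ^ a.+1 * m1 ^ (v - (i' + a.+1))).
have ME : m1 ^ v = b1 * c.
  by rewrite vE !expnD c'E /c; ring.
have m1c : m1 ^ a.+1 %| c by rewrite /c dvdn_mull // dvdn_mulr.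
have m2k : 1 < m2 ^ k by rewrite -[1](expn0 m2) ltn_exp2l.
(* With [m1 ^ v * z = m2 ^ k * n + 1], the number [m2 ^ (d + k) * n + 1] equals
   [m2 ^ d * m1 ^ v * z - (m2 ^ d - 1)], from which [b1] factors out. *)
have key z : z = 1 %[mod m2 ^ k] -> 0 < m2 ^ d * c * z - b2 /\
    F (m1 ^ v * z) = (F b1 * F (m2 ^ d * c * z - b2)%N)%R.
  move=> z1.
  have y1 : m1 ^ v * z = 1 %[mod m2 ^ k].
    by rewrite -modnMml M1 modnMml mul1n.
  have [n nE] : exists n, m1 ^ v * z = m2 ^ k * n + 1.
    exists (m1 ^ v * z %/ m2 ^ k).
    by rewrite [LHS](divn_eq _ (m2 ^ k)) y1 (modn_small m2k) mulnC.
  have y'E : m2 ^ (d + k) * n + 1 = b1 * (m2 ^ d * c * z - b2).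
    rewrite mulnBr -bE.
    have -> : b1 * (m2 ^ d * c * z) = m2 ^ d * (m2 ^ k * n + 1).
      by rewrite -nE ME; ring.
    rewrite expnD -mulnA -(addKn (m2 ^ d - 1) (_ + 1)); congr (_ - _).
    by rewrite mulnDr muln1 addnCA subnK // ltnW.
  split; first by case: (_ - b2) y'E => //; rewrite muln0 addn1.
  by rewrite nE eq2 y'E FM.
exists k => // z z1; have [e1 f1] := key 1 erefl; have [ez fz] := key z z1.
apply: (mulfI (Fnz (m1 ^ v) _)); first by rewrite expn_gt0; lia.
rewrite -FM mulr1 fz -[m1 ^ v in RHS]muln1 f1; congr (_ * _)%R.
have zE : z = z %/ m2 ^ k * m2 ^ k + 1.
  by rewrite [LHS](divn_eq _ (m2 ^ k)) z1 (modn_small m2k).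
(* Passing from 1 to [z] changes the argument of the second factor by a multiple of the period,
   since [m1 ^ a.+1] divides [c] and [a <= k]. *)
have /dvdnP[w wE] : (m1 * m2) ^ a %| c * m2 ^ k.
  rewrite expnMn dvdn_mul //; last by rewrite dvdn_exp2l.
  by apply: dvdn_trans m1c; rewrite expnS dvdn_mull.
have -> : m2 ^ d * c * z - b2 =
    m2 ^ d * c * 1 - b2 + m2 ^ d * (z %/ m2 ^ k) * w * (m1 * m2) ^ a.
  rewrite -[_ * w * _]mulnA -wE {1}zE.
  have -> : m2 ^ d * c * (z %/ m2 ^ k * m2 ^ k + 1) =
    m2 ^ d * c * 1 + m2 ^ d * (z %/ m2 ^ k) * (c * m2 ^ k) by ring.
  by rewrite addnBAC // ltnW // -subn_gt0.
have copr m : m %| m2 ^ d * c -> coprime b2 m -> coprime (m2 ^ d * c * 1 - b2) m.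
  by move=> mA; apply: coprime_subl; [rewrite ltnW // -subn_gt0 | rewrite muln1].
apply: per => //; rewrite coprimeMr !copr //.
  by rewrite dvdn_mulr // dvdn_exp.
by apply: dvdn_mull; apply: dvdn_trans m1c; rewrite dvdn_exp.
Qed.

(** Take [x] congruent to [n] modulo [m1 ^ k1] and to 1 modulo [m2 ^ k2], so [F x = 1]. If [n']
    inverts [n] modulo [m1 ^ k1], then [F (x * n') = F (n * n') = 1], whence [F n = F x]. *)
Lemma constant_on_coprimes (K : idomainType) (F : nat -> K) (m1 m2 : nat) :
  1 < m1 -> 1 < m2 -> coprime m1 m2 ->
  nonvanishing_multiplicative F -> automatic (m1 * m2) F ->
  forall n, 0 < n -> coprime n m1 -> F n = 1%R.
Proof.
move=> m1g m2g cm FP aF n n0 cn; have [F1 FM Fnz] := FP.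
have [k2 k20 H2] := constant_on_residue_one m1g m2g cm FP aF.
have [k1 k10 H1] : exists2 k, 0 < k & forall z, z = 1 %[mod m1 ^ k] -> F z = 1%R.
  by apply: (constant_on_residue_one m2g m1g _ FP); rewrite 1?coprime_sym 1?mulnC.
have ck : coprime (m1 ^ k1) (m2 ^ k2) by rewrite coprimeXl // coprimeXr.
pose x := chinese (m1 ^ k1) (m2 ^ k2) n 1.
have Fx : F x = 1%R by apply: H2; rewrite chinese_modr.
have t0 : 0 < totient (m1 ^ k1) by rewrite totient_gt0 expn_gt0 ltnW.
have nt : n * n ^ (totient (m1 ^ k1)).-1 = 1 %[mod m1 ^ k1].
  by rewrite -expnS prednK // Euler_exp_totient ?coprimeXr.
have := H1 _ nt; rewrite FM => <-.
rewrite -[LHS]mulr1; congr (_ * _)%R; rewrite -(H1 (x * n ^ (totient (m1 ^ k1)).-1)).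
  by rewrite FM Fx mul1r.
by rewrite -modnMml chinese_modl // modnMml.
Qed.

Lemma constant_of_coprime_factors (K : idomainType) (F : nat -> K) (m1 m2 : nat) :
  1 < m1 -> 1 < m2 -> coprime m1 m2 ->
  nonvanishing_multiplicative F -> automatic (m1 * m2) F ->
  forall n, 0 < n -> F n = 1%R.
Proof.
move=> m1g m2g cm FP aF n n0; have [F1 FM Fnz] := FP.
have [a [b [c [nE bm1 cm1]]]] := smooth_coprime_part m1 n0.
have b0 : 0 < b by case: (b) nE n0 => // ->.
have c0 : 0 < c by case: (c) nE n0 => // ->; rewrite muln0.
rewrite nE FM (constant_on_coprimes m1g m2g cm FP aF c0 cm1) mulr1.
apply: (constant_on_coprimes m2g m1g _ FP _ b0).
- by rewrite coprime_sym.
- by rewrite mulnC.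
- by apply: (coprime_dvdl bm1); rewrite coprimeXl.
Qed.

Lemma automatic_prime_power (K : idomainType) (F : nat -> K) (q : nat) :
  1 < q -> nonvanishing_multiplicative F -> automatic q F ->
  ~ (forall n, 0 < n -> F n = 1%R) ->
  exists p e, [/\ prime p, 0 < e & q = p ^ e].
Proof.
move=> q1 FP aF nF; pose p := pdiv q.
have pp : prime p by apply: pdiv_prime.
have q0 : 0 < q by apply: ltnW.
have [m cpm qE] := pfactor_coprime pp q0.
have e0 : 0 < logn p q by rewrite logn_gt0 mem_primes pp q0 pdiv_dvd.
exists p, (logn p q); split=> //.
have [m1|m1] := ltnP 1 m; last first.
  have m0 : 0 < m by case: (m) qE q0 => // ->.
  have m1' : m = 1 by lia.
  by rewrite [LHS]qE m1' mul1n.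
case: nF; apply: (@constant_of_coprime_factors _ F m (p ^ logn p q)) => //.
- by rewrite -[1](expn0 p) ltn_exp2l // prime_gt1.
- by rewrite coprimeXr // coprime_sym.
- by rewrite -qE.
Qed.

(** * Mockulus p, roots of unity and the Dirichlet character *)

Lemma automatic_root (K : fieldType) (F : nat -> K) (p e : nat) :
  0 < p -> 0 < e -> nonvanishing_multiplicative F ->
  automatic (p ^ e) F -> automatic p F.
Proof.
move=> p0 e0 [_ FM Fnz] aF.
pose g (x : nat * (nat -> K)) := fun m => ((F (p ^ x.1)%N)^-1 * x.2 m)%R.
apply: sub_finite_set (finite_image g (finite_setX (finite_II e.+1) aF)).
(* Multiplying the argument by [p ^ c] raises the level to [c + k], a multiple of [e], and costs
   only the factor [F (p ^ c)]; as [c <= e], finitely many factors occur. *)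
move=> _ [k [r [rk ->]]]; pose c := e - k %% e.
have kE : e * (k %/ e).+1 = c + k.
  have := ltn_pmod k e0; have := divn_eq k e.
  by rewrite mulnS /c [e * _]mulnC; lia.
exists (c, fun m => F ((p ^ e) ^ (k %/ e).+1 * m + p ^ c * r)).
  split=> /=; first by rewrite ltnS leq_subr.
  exists (k %/ e).+1, (p ^ c * r); split=> //.
  by rewrite -expnM kE expnD ltn_pmul2l // expn_gt0 p0.
apply/funext => m; rewrite /g /= -expnM kE expnD -mulnA -mulnDr FM mulKf //.
by apply: Fnz; rewrite expn_gt0 p0.
Qed.

(** The powers [n ^ i] serve as residues of kernel elements; two of these coincide, and their
    initial terms give [F n ^+ i = F n ^+ j] with [i < j]. *)
Lemma automatic_root_of_unity (K : idomainType) (F : nat -> K) (q n : nat) :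
  1 < q -> nonvanishing_multiplicative F -> automatic q F -> 0 < n ->
  is_root_of_unity (F n).
Proof.
move=> q1 [F1 FM Fnz] /finite_set_pigeonhole[N HN] n0.
have [i _|i [j [ij _ e]]] := HN (fun i m => F (q ^ (n ^ i) * m + n ^ i)).
  by exists (n ^ i), (n ^ i); split=> //; apply: ltn_expl.
have FX k : F (n ^ k)%N = (F n ^+ k)%R.
  by elim: k => [|k IH]; rewrite ?expn0 // expnS exprS FM IH.
exists (j - i); first by rewrite subn_gt0.
apply/unity_rootP/(mulfI (Fnz (n ^ i) _)); first by rewrite expn_gt0 n0.
have /= := congr1 (fun g => g 0) e; rewrite !muln0 !add0n !FX => eij.
by rewrite -exprD subnKC ?mulr1 // ltnW.
Qed.

(** The nonnegative remainder modulo the period [L] extends [F] to negative integers. *)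
Definition character_of (K : idomainType) (F : nat -> K) (p L : nat) (n : int) : K :=
  if p %| `|n| then 0%R else F `|(n %% L%:Z)%Z|.

Lemma character_of_dirichlet (K : idomainType) (F : nat -> K) (p r : nat) :
  prime p -> 0 < r -> nonvanishing_multiplicative F ->
  (forall j n, 0 < n -> coprime n p -> F (n + j * p ^ r) = F n) ->
  dirichlet_character (p ^ r) (character_of F p (p ^ r)) /\
  (forall n : nat, 0 < n -> coprime n p -> character_of F p (p ^ r) n%:Z = F n).
Proof.
move=> pp r0 [F1 FM Fnz] per; pose L := p ^ r; rewrite -/L in per *.
have p1 := prime_gt1 pp.
have L0 : 0 < L by rewrite expn_gt0 ltnW.
have pL : p %| L by rewrite dvdn_exp.
have L1 : 1 < L by rewrite -[1](expn0 p) ltn_exp2l.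
have dvdp n : coprime n p = ~~ (p %| n) by rewrite coprime_sym prime_coprime.
have pmod n : (p %| n %% L) = (p %| n) by rewrite /dvdn modn_dvdm.
(* Periodicity is available at positive arguments only, so the remainder must first be shown
   nonzero. *)
have Fmod n : coprime n p -> 0 < n %% L /\ F (n %% L) = F n.
  rewrite dvdp => pn.
  have n0 : 0 < n %% L by rewrite lt0n; apply: contraNneq pn => e; rewrite -pmod e dvdn0.
  by split=> //; rewrite [in RHS](divn_eq n L) addnC per // dvdp pmod.
pose res (n : int) := `|(n %% L%:Z)%Z|%N.
have resE n : Posz (res n) = (n %% L%:Z)%Z by rewrite /res gez0_abs ?modz_ge0 //; lia.
have pres n : (p %| res n) = (p %| `|n|).
  rewrite -[LHS]/((p %| Posz (res n))%Z) resE -[RHS]/((p %| n)%Z).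
  rewrite [in RHS](divz_eq n L%:Z) [RHS]rpredDl //.
  exact: dvdz_mull.
have resM m n : res (m * n)%R = (res m * res n) %% L.
  apply/eqP; rewrite -eqz_nat resE -modz_nat PoszM !resE.
  by rewrite modzMml modzMmr.
have res_lt n : res n < L by rewrite -ltz_nat resE ltz_pmod.
have res_gt0 n : ~~ (p %| `|n|) -> 0 < res n.
  by rewrite -pres; apply: contraNltn; rewrite leqn0 => /eqP ->; rewrite dvdn0.
have chinat n : 0 < n -> coprime n p -> character_of F p L n%:Z = F n.
  move=> n0 cn; rewrite /character_of /= -[p %| n]negbK -dvdp cn /=.
  by rewrite modz_nat /=; case: (Fmod n cn).
split=> //; split=> [|n|n].
- split; first by rewrite chinat // coprime1n.
  move=> m n; rewrite /character_of abszM Euclid_dvdM //.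
  case: ifP => [/orP[]-> |]; rewrite ?mul0r ?mulr0 //.
  move=> /negbT; rewrite negb_or => /andP[pm pn].
  rewrite (negbTE pm) (negbTE pn) -!/(res _) resM -FM.
  by apply: (Fmod _ _).2; rewrite dvdp Euclid_dvdM // !pres negb_or pm.
- rewrite /character_of modzDr; congr (if _ then _ else _).
  by rewrite -[LHS]pres -[RHS]pres /res modzDr.
- rewrite /character_of; split=> [|g1].
    case: ifP => [pn _ /(congr1 absz) /= g1|/negbT pn /eqP].
      have : coprime `|n| p by rewrite -(coprime_pexpr _ _ r0) /coprime g1.
      by rewrite dvdp pn.
    by rewrite (negbTE (Fnz _ (res_gt0 n pn))).
  case: ifP => // /negbT pn; case: g1.
  have /eqP cnL : coprime `|n| L by rewrite coprimeXr // dvdp.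
  by rewrite -[LHS]/(Posz (gcdn `|n| L)) cnL.
Qed.

Local Open Scope ring_scope.

Theorem theorem2p11 (R : realType) (q : nat) (f : int -> R[i]) (hq : (2 <= q)%N)
    (hf : mock_character q f)
    (hnz : forall n : nat, (1 <= n)%N -> f n%:Z <> 0) :
  exists (xi : R[i]) (p r : nat) (chi : int -> R[i]),
    [/\ is_root_of_unity xi, prime p, (0 < r)%N & dirichlet_character (p ^ r) chi]
    /\ (forall n : nat, (1 <= n)%N ->
          f n%:Z = xi ^+ logn p n * chi (n %/ p ^ logn p n)%N%:Z)
    /\ mock_character p f.
Proof.
have [_ [f1 fM] aF nper fd] := hf; pose F n := f n%:Z.
have FP : nonvanishing_multiplicative F.
  by split=> // [m n|n n0]; [rewrite /F PoszM fM | apply/eqP/hnz].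
have [_ FM Fnz] := FP.
have [p [e [pp e0 qE]]] : exists p e, [/\ prime p, (0 < e)%N & q = (p ^ e)%N].
  apply: automatic_prime_power FP aF _ => // F1; apply: nper.
  by exists 1%N, 1%N; split=> // n n0; rewrite -!/(F _) !F1 // addn1.
have p0 := prime_gt0 pp.
have [a a0 per] := power_period_on_coprimes hq FP aF.
have [||chiP chiE] := @character_of_dirichlet _ F p (e * a)%N pp _ FP.
- by rewrite muln_gt0 e0.
- by move=> j n n0 cn; rewrite expnM -qE per // qE coprimeXr.
exists (F p), p, (e * a)%N, (character_of F p (p ^ (e * a))%N); split; last split.
- split=> //; last by rewrite muln_gt0 e0.
  exact: automatic_root_of_unity hq FP aF p0.
- move=> n n0; have [m cpm nE] := pfactor_coprime pp n0.
  have -> : (n %/ p ^ logn p n)%N = m by rewrite {1}nE mulnK // expn_gt0 p0.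
  have m0 : (0 < m)%N by case: (m) nE n0 => // ->.
  rewrite chiE //; last by rewrite coprime_sym.
  rewrite -/(F n) {1}nE mulnC FM; congr (_ * _).
  elim: (logn p n) => [|k IH]; first by rewrite expn0 expr0.
  by rewrite expnS exprS FM IH.
- split=> //; first exact: prime_gt1.
  by apply: automatic_root p0 e0 FP _; rewrite -qE.
Qed.
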